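(* Assume that the eigenvalues of $p^{-1}B'B$ are bounded away from zero for all large $p$, that $\Sigma=B\,\mathrm{cov}(f_t)B'+\Sigma_u$, and that the canonical condition holds: $\mathrm{cov}(f_t)=I_K$ and $B'B$ is diagonal. If $\{\|\tilde b_j\|\}_{j=1}^K$ are distinct, then $$\big\|\xi_j-\tilde b_j/\|\tilde b_j\|\big\|=O(p^{-1}\|\Sigma_u\|)\qquad\text{for }j\le K.$$
   Context: $K$ is a fixed positive integer and $p\to\infty$. The factor model is $y_t=Bf_t+u_t$, where $B$ is a $p\times K$ non-random matrix, $f_t\in\mathbb R^K$ is a vector of common factors and $u_t\in\mathbb R^p$ an error vector uncorrelated with $f_t$; $\Sigma_u=\mathrm{cov}(u_t)$ and $\Sigma=\mathrm{cov}(y_t)$. $\tilde b_1,\dots,\tilde b_K$ are the columns of $B$, ordered so that $\|\tilde b_1\|\ge\dots\ge\|\tilde b_K\|$. $\lambda_1\ge\dots\ge\lambda_p$ are the eigenvalues of $\Sigma$ and $\xi_1,\dots,\xi_p$ the corresponding orthonormal eigenvectors, with the sign of $\xi_j$ chosen so that $\xi_j'\tilde b_j\ge0$ for $j\le K$. $\|\cdot\|$ is the Euclidean norm for vectors and the spectral norm for matrices.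
   Formalization: ''Distinct'' is read as: the squared norms of the columns of B differ pairwise by at least cp for some c>0 and all large p; if the norms merely differ for each p the claim fails (norms squared p+1/p and p, K=2, with correlated errors). *)

(* Defs.v *)
From mathcomp Require Import all_boot all_order all_algebra.
From mathcomp Require Import all_classical all_reals all_analysis.

Set Implicit Arguments.
Unset Strict Implicit.
Unset Printing Implicit Defensive.

Import Order.TTheory GRing.Theory Num.Theory.
Import numFieldNormedType.Exports.

Local Open Scope classical_set_scope.
Local Open Scope ring_scope.

(* The norm `|_| that MathComp-Analysis puts on matrices is the max norm, so
   the Euclidean and the spectral norms are defined here. *)
Definition enorm (R : realType) (n : nat) (v : 'cV[R]_n) : R :=
  Num.sqrt (\sum_(i < n) v i 0 ^+ 2).

Definition spectral_norm (R : realType) (m n : nat) (A : 'M[R]_(m, n)) : R :=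
  sup [set enorm (A *m x) | x in [set x : 'cV[R]_n | enorm x <= 1]].

(* `covariance` is \bar R-valued; it is finite for the square-integrable
   variables considered here, so `fine` loses nothing. *)
Definition covmx (R : realType) (d : measure_display) (T : measurableType d)
    (P : probability T R) (n : nat) (X : 'I_n -> {RV P >-> R}) : 'M[R]_n :=
  \matrix_(i < n, j < n) fine (covariance P (X i) (X j)).

(* The eigenpairs of an n x n matrix are indexed from 0 by nat; the values of
   lam and xi at indices >= n are irrelevant.  The eigenvalues are listed with
   multiplicity, in nonincreasing order. *)
Definition ordered_eigensystem (R : realType) (n : nat) (A : 'M[R]_n)
    (lam : nat -> R) (xi : nat -> 'cV[R]_n) : Prop :=
  [/\ forall i, (i < n)%N -> A *m xi i = lam i *: xi i,
      forall i j, (i < n)%N -> (j < n)%N ->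
        (xi i)^T *m xi j = ((i == j)%:R)%:M
    & forall i j, (i <= j)%N -> (j < n)%N -> lam j <= lam i].

Definition eigenvalues_bounded_away_from_zero (R : realType) (n : nat)
    (A : nat -> 'M[R]_n) : Prop :=
  exists2 c : R, 0 < c &
    \forall p \near \oo, forall a : R, eigenvalue (A p) a -> c <= `|a|.

(* Distinctness of the column norms along the sequence p -> oo: on the scale p
   of the squared norms (which, when B'B is diagonal, are p times the
   eigenvalues of p^-1 B'B), the gaps do not vanish in the limit.  If the
   norms were only required to differ for each p, the gaps could shrink
   arbitrarily fast and the eigenvectors would not be consistent. *)
Definition asymptotically_distinct_columns (R : realType) (K : nat)
    (B : forall p : nat, 'M[R]_(p, K)) : Prop :=
  exists2 c : R, 0 < c &
    \forall p \near \oo, forall i j : 'I_K, i != j ->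
      c * p%:R <= `| enorm (col i (B p)) ^+ 2 - enorm (col j (B p)) ^+ 2 |.

(* Main.v *)
Require Import Defs.
From mathcomp Require Import all_boot all_order all_algebra.
From mathcomp Require Import all_classical all_reals all_analysis.
From mathcomp Require Import ring lra.

Import Order.TTheory GRing.Theory Num.Theory.
Import numFieldNormedType.Exports.

Local Open Scope classical_set_scope.
Local Open Scope ring_scope.

(** Write e_i = b_i / |b_i| and s = |Sigma_u|, and let g be of order p and below
    all the |b_i|^2 and all their gaps.  If s >= g / 2 the claim holds because
    unit vectors are at distance at most 2.  Otherwise Weyl's inequality
    |lam_j - |b_j|^2| <= s keeps lam_j at distance at least g / 2 from 0 and from
    |b_i|^2 for i <> j.  Pairing Sigma xi_j = lam_j xi_j with e_i gives
    (lam_j - |b_i|^2) <e_i, xi_j> = <e_i, Sigma_u xi_j>, and pairing it with the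
    component w of xi_j orthogonal to all e_i gives
    lam_j |w|^2 = <w, Sigma_u xi_j>; hence xi_j is within 2 K s / g of its
    projection on e_j, whose coefficient is nonnegative and therefore close
    to 1. *)

(** * Inner product, norms and orthonormal families *)

Section EuclideanSpace.
Set Implicit Arguments.
Unset Strict Implicit.
Unset Printing Implicit Defensive.
Context {R : realType}.

Definition dot {n : nat} (x y : 'cV[R]_n) : R := \sum_(i < n) x i 0 * y i 0.

Lemma dotE n (x y : 'cV[R]_n) : dot x y = (x^T *m y) 0 0.
Proof. by rewrite mxE; apply: eq_bigr => i _; rewrite mxE. Qed.

Lemma dotC n (x y : 'cV[R]_n) : dot x y = dot y x.
Proof. by apply: eq_bigr => i _; rewrite mulrC. Qed.

Lemma dotDr n (x y z : 'cV[R]_n) : dot x (y + z) = dot x y + dot x z.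
Proof. by rewrite -big_split; apply: eq_bigr => i _; rewrite !mxE mulrDr. Qed.

Lemma dotZr n a (x y : 'cV[R]_n) : dot x (a *: y) = a * dot x y.
Proof. by rewrite mulr_sumr; apply: eq_bigr => i _; rewrite mxE mulrCA. Qed.

Lemma dot0r n (x : 'cV[R]_n) : dot x 0 = 0.
Proof. by rewrite -(scale0r x) dotZr mul0r. Qed.

Lemma dotBr n (x y z : 'cV[R]_n) : dot x (y - z) = dot x y - dot x z.
Proof. by rewrite dotDr -scaleN1r dotZr mulN1r. Qed.

Lemma dotDl n (x y z : 'cV[R]_n) : dot (y + z) x = dot y x + dot z x.
Proof. by rewrite dotC dotDr !(dotC x). Qed.

Lemma dotZl n a (x y : 'cV[R]_n) : dot (a *: y) x = a * dot y x.
Proof. by rewrite dotC dotZr dotC. Qed.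

Lemma dotBl n (x y z : 'cV[R]_n) : dot (y - z) x = dot y x - dot z x.
Proof. by rewrite dotC dotBr !(dotC x). Qed.

Lemma dot_sumr n (I : finType) (x : 'cV[R]_n) (F : I -> 'cV[R]_n) :
  dot x (\sum_i F i) = \sum_i dot x (F i).
Proof.
exact: (big_morph (dot x) (dotDr x) (dot0r x)).
Qed.

Lemma dot_ge0 n (x : 'cV[R]_n) : 0 <= dot x x.
Proof. by apply: sumr_ge0 => i _; rewrite -expr2 sqr_ge0. Qed.

Lemma dot_eq0 n (x : 'cV[R]_n) : (dot x x == 0) = (x == 0).
Proof.
apply/eqP/eqP => [x0|->]; last by rewrite dot0r.
apply/matrixP => i j; rewrite ord1 mxE.
have /eqP := x0; rewrite psumr_eq0 => [|k _]; last by rewrite -expr2 sqr_ge0.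
by move/allP/(_ i (mem_index_enum i)); rewrite mulf_eq0 orbb => /eqP.
Qed.

Lemma enormE n (x : 'cV[R]_n) : enorm x = Num.sqrt (dot x x).
Proof. by congr Num.sqrt; apply: eq_bigr => i _; rewrite expr2. Qed.

Lemma enorm_ge0 n (x : 'cV[R]_n) : 0 <= enorm x.
Proof. exact: sqrtr_ge0. Qed.

Lemma sqr_enorm n (x : 'cV[R]_n) : enorm x ^+ 2 = dot x x.
Proof. by rewrite enormE sqr_sqrtr ?dot_ge0. Qed.

Lemma enorm_eq0 n (x : 'cV[R]_n) : (enorm x == 0) = (x == 0).
Proof. by rewrite -dot_eq0 -sqr_enorm sqrf_eq0. Qed.

Lemma enormZ n a (x : 'cV[R]_n) : enorm (a *: x) = `|a| * enorm x.
Proof.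
by rewrite !enormE dotZl dotZr mulrA -expr2 sqrtrM ?sqr_ge0 // sqrtr_sqr.
Qed.

Lemma enorm0 n : enorm (0 : 'cV[R]_n) = 0.
Proof. by apply/eqP; rewrite enorm_eq0. Qed.

Lemma enormN n (x : 'cV[R]_n) : enorm (- x) = enorm x.
Proof. by rewrite -scaleN1r enormZ normrN1 mul1r. Qed.

Lemma cauchy_schwarz n (x y : 'cV[R]_n) : `|dot x y| <= enorm x * enorm y.
Proof.
rewrite -(ler_pXn2r (_ : 0 < 2)%N) ?nnegrE ?mulr_ge0 ?enorm_ge0 //.
rewrite real_normK ?num_real // exprMn !sqr_enorm.
have [->|y0] := eqVneq y 0.
  by rewrite !dot0r expr0n mulr0.
have y_gt0 : 0 < dot y y by rewrite lt0r dot_eq0 y0 dot_ge0.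
(* This square expands to [dot y y] times the Cauchy-Schwarz defect
   [dot x x * dot y y - dot x y ^+ 2]. *)
have := dot_ge0 (dot y y *: x - dot x y *: y).
rewrite dotBl !dotBr !dotZl !dotZr (dotC y x).
rewrite -subr_ge0 -(pmulr_rge0 (dot x x * dot y y - _) y_gt0).
by move=> h; apply: le_trans h _; rewrite le_eqVlt; apply/orP; left; apply/eqP; ring.
Qed.

Lemma enormD n (x y : 'cV[R]_n) : enorm (x + y) <= enorm x + enorm y.
Proof.
rewrite -(ler_pXn2r (_ : 0 < 2)%N) ?nnegrE ?addr_ge0 ?enorm_ge0 //.
rewrite sqr_enorm sqrrD !sqr_enorm dotDl !dotDr (dotC y x).
have := le_trans (ler_norm _) (cauchy_schwarz x y).
by rewrite mulr2n; lra.
Qed.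

Lemma enorm_sum n (I : finType) (Q : pred I) (F : I -> 'cV[R]_n) :
  enorm (\sum_(i | Q i) F i) <= \sum_(i | Q i) enorm (F i).
Proof.
apply: (big_ind2 (fun x a => enorm x <= a)) => [|x a y b xa yb|//].
  by rewrite enorm0.
exact: le_trans (enormD _ _) (lerD xa yb).
Qed.

Lemma dot_row n m (A : 'M[R]_(m, n)) (x : 'cV[R]_n) i :
  (A *m x) i 0 = dot (row i A)^T x.
Proof. by rewrite mxE; apply: eq_bigr => k _; rewrite !mxE. Qed.

(** By homogeneity it suffices to treat the unit ball, where the value is at most the supremum once
    the set is known to be bounded. *)
Lemma spectral_norm_bound n m (A : 'M[R]_(m, n)) (x : 'cV[R]_n) :
  enorm (A *m x) <= spectral_norm A * enorm x.
Proof.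
have bnd : has_ubound
    [set enorm (A *m x) | x in [set x : 'cV[R]_n | enorm x <= 1]].
  (* The Frobenius norm is an upper bound, by Cauchy-Schwarz applied to each row. *)
  exists (Num.sqrt (\sum_i enorm (row i A)^T ^+ 2)) => _ [z /= z1 <-].
  rewrite /enorm ler_wsqrtr // ler_sum // => i _.
  rewrite dot_row -real_normK ?num_real // lerXn2r ?nnegrE ?enorm_ge0 //.
  by rewrite (le_trans (cauchy_schwarz _ _)) // ler_piMr ?enorm_ge0.
have [->|x0] := eqVneq x 0.
  by rewrite mulmx0 !enorm0 mulr0.
have nx0 : 0 < enorm x by rewrite lt0r enorm_eq0 x0 enorm_ge0.
rewrite -ler_pdivrMr // mulrC.
have -> : (enorm x)^-1 * enorm (A *m x) = enorm (A *m ((enorm x)^-1 *: x)).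
  by rewrite -scalemxAr enormZ ger0_norm // invr_ge0 enorm_ge0.
apply: (ub_le_sup bnd); exists ((enorm x)^-1 *: x) => //=.
by rewrite enormZ ger0_norm ?invr_ge0 ?enorm_ge0 // mulVf ?gt_eqF.
Qed.

Lemma dot_mulmx_bound n (A : 'M[R]_n) (x y : 'cV[R]_n) :
  `|dot x (A *m y)| <= spectral_norm A * (enorm x * enorm y).
Proof.
rewrite mulrCA; apply: le_trans (cauchy_schwarz _ _) _.
by rewrite ler_wpM2l ?enorm_ge0 ?spectral_norm_bound.
Qed.

Definition orthonormal_family {n m : nat} (e : 'I_m -> 'cV[R]_n) : Prop :=
  forall i k, dot (e i) (e k) = (i == k)%:R.

Section Orthonormal.
Context {n m : nat} {e : 'I_m -> 'cV[R]_n}.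
Hypothesis e_on : orthonormal_family e.

Lemma enorm_orthonormal i : enorm (e i) = 1.
Proof. by rewrite enormE e_on eqxx sqrtr1. Qed.

Lemma dot_orthonormal_sum (a : 'I_m -> R) k :
  dot (e k) (\sum_i a i *: e i) = a k.
Proof.
rewrite dot_sumr (bigD1 k) //= dotZr e_on eqxx mulr1 big1 ?addr0 // => i ik.
by rewrite dotZr e_on eq_sym (negPf ik) mulr0.
Qed.

Definition residual (x : 'cV[R]_n) : 'cV[R]_n :=
  x - \sum_i dot (e i) x *: e i.

Lemma dot_residual x k : dot (e k) (residual x) = 0.
Proof. by rewrite dotBr dot_orthonormal_sum subrr. Qed.

Lemma dot_residual_sum x (a : 'I_m -> R) :
  dot (residual x) (\sum_i a i *: e i) = 0.
Proof.
by rewrite dot_sumr big1 // => i _; rewrite dotZr dotC dot_residual mulr0.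
Qed.

Lemma dot_residual_self x : dot (residual x) x = dot (residual x) (residual x).
Proof. by rewrite dotBr dot_residual_sum subr0. Qed.

(** The difference of the two sides is the squared norm of the residual. *)
Lemma bessel x : \sum_i dot (e i) x ^+ 2 <= dot x x.
Proof.
have := dot_ge0 (residual x).
rewrite -dot_residual_self dotBl subr_ge0 dotC dot_sumr.
by under eq_bigr do rewrite dotZr (dotC x) -expr2.
Qed.

End Orthonormal.

Lemma orthonormal_basis_expansion n (e : 'I_n -> 'cV[R]_n) :
  orthonormal_family e -> forall x, x = \sum_i dot (e i) x *: e i.
Proof.
move=> e_on x; pose X := \matrix_(i < n, l < n) e l i 0.
(* The columns of [X] are the [e l], so orthonormality reads [X^T *m X = 1%:M]; since [X] is square,
   the factors may be swapped. *)
have XX : X *m X^T = 1%:M.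
  apply: mulmx1C; apply/matrixP => i k; rewrite !mxE -e_on.
  by apply: eq_bigr => l _; rewrite !mxE.
rewrite -[LHS]mul1mx -XX -mulmxA; apply/matrixP => i k.
rewrite ord1 summxE mxE; apply: eq_bigr => l _; rewrite !mxE mulrC.
by congr (_ * _); apply: eq_bigr => q _; rewrite !mxE.
Qed.

(* The coefficients of x solve a homogeneous m x m system: the equations l < j
   say that x is orthogonal to v l, the equations l > j that the coefficient
   on e l vanishes, and equation j is void, so the system is singular. *)
Lemma exists_orthogonal_combination n m (e v : 'I_m -> 'cV[R]_n) (j : 'I_m) :
  orthonormal_family e ->
  exists x : 'cV[R]_n,
    [/\ 0 < dot x x,
        x = \sum_i dot (e i) x *: e i,
        forall i : 'I_m, (j < i)%N -> dot (e i) x = 0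
      & forall l : 'I_m, (l < j)%N -> dot (v l) x = 0].
Proof.
move=> e_on.
pose M : 'M[R]_m := \matrix_(i, l)
  if (l < j)%N then dot (v l) (e i) else if l == j then 0 else (l == i)%:R.
have /det0P[a a0 aM] : \det M == 0.
  rewrite (expand_det_col M j) big1 // => i _.
  by rewrite mxE ltnn eqxx mul0r.
pose x := \sum_i a 0 i *: e i.
have ex i : dot (e i) x = a 0 i by rewrite dot_orthonormal_sum.
have xE : x = \sum_i dot (e i) x *: e i by under eq_bigr do rewrite ex.
have aMl l : \sum_i a 0 i * M i l = 0.
  by move/matrixP: aM => /(_ 0 l); rewrite !mxE.
exists x; split => // [|i ji|l lj].
- rewrite lt0r dot_ge0 andbT dot_eq0; apply: contra_neq a0 => x0.
  apply/matrixP => i k; rewrite ord1 -ex x0 mxE.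
  by rewrite dot0r.
- rewrite ex -(aMl i) (bigD1 i) //= mxE ltnNge (ltnW ji) /=.
  rewrite -val_eqE /= gtn_eqF // eqxx mulr1 big1 ?addr0 // => k ki.
  by rewrite mxE ltnNge (ltnW ji) /= -val_eqE /= gtn_eqF // eq_sym (negPf ki) mulr0.
- rewrite -(aMl l) dot_sumr; apply: eq_bigr => i _.
  by rewrite mxE lj dotZr.
Qed.

End EuclideanSpace.

(** * Orthonormal spikes [e i] of strength [nu i], perturbed by [S] *)

Section SpikedMatrix.
Set Implicit Arguments.
Unset Strict Implicit.
Context {R : realType} {n m : nat} {e : 'I_m -> 'cV[R]_n} {nu : 'I_m -> R}.
Context {S Sigma : 'M[R]_n} {lam : nat -> R} {xi : nat -> 'cV[R]_n}.
Hypothesis m_le_n : (m <= n)%N.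
Hypothesis e_on : orthonormal_family e.
Hypothesis nu_ge0 : forall i, 0 <= nu i.
Hypothesis nu_anti : forall i j : 'I_m, (i <= j)%N -> nu j <= nu i.
Hypothesis SigmaE : forall x,
  Sigma *m x = \sum_i (nu i * dot (e i) x) *: e i + S *m x.
Hypothesis eig : ordered_eigensystem Sigma lam xi.

Local Notation s := (spectral_norm S).

Lemma eigenvector_eq i : (i < n)%N -> Sigma *m xi i = lam i *: xi i.
Proof. by case: eig => + _ _; exact. Qed.

Lemma eigenvector_dot i j :
  (i < n)%N -> (j < n)%N -> dot (xi i) (xi j) = (i == j)%:R.
Proof.
case: eig => _ xi_on _ i_n j_n.
by rewrite dotE xi_on // mxE eqxx mulr1n.
Qed.

Lemma eigenvectors_orthonormal k :
  (k <= n)%N -> orthonormal_family (fun i : 'I_k => xi i).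
Proof. by move=> kn i j; rewrite eigenvector_dot // (leq_trans (ltn_ord _)). Qed.

Lemma quadratic_form_spiked x y :
  dot y (Sigma *m x) = \sum_i nu i * dot (e i) x * dot (e i) y + dot y (S *m x).
Proof.
rewrite SigmaE dotDr dot_sumr; congr (_ + _).
by apply: eq_bigr => i _; rewrite dotZr (dotC y).
Qed.

(** Serves with [k = n] for any vector and with [k = m] for vectors in the span of the leading
    eigenvectors. *)
Lemma quadratic_form_eigen k x : (k <= n)%N ->
  x = \sum_(i < k) dot (xi i) x *: xi i ->
  dot x (Sigma *m x) = \sum_(i < k) lam i * dot (xi i) x ^+ 2.
Proof.
move=> kn xE; rewrite {2}xE mulmx_sumr dot_sumr; apply: eq_bigr => i _.
rewrite -scalemxAr eigenvector_eq ?(leq_trans (ltn_ord i)) //.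
by rewrite !dotZr (dotC x) mulrCA expr2.
Qed.

Lemma dot_combination k (a : 'I_k -> 'cV[R]_n) x :
  x = \sum_i dot (a i) x *: a i -> dot x x = \sum_i dot (a i) x ^+ 2.
Proof.
move=> xE; rewrite {2}xE dot_sumr; apply: eq_bigr => i _.
by rewrite dotZr (dotC x) expr2.
Qed.

Lemma spectral_norm_quadratic x : `|dot x (S *m x)| <= s * dot x x.
Proof. by rewrite -sqr_enorm expr2 dot_mulmx_bound. Qed.

(** Courant-Fischer argument: take a nonzero [x] in the span of the [e i], [i <= j], orthogonal to
    every [xi l], [l < j]. The spikes contribute at least [nu j * dot x x] to the quadratic form and
    [S] lowers it by at most [s * dot x x], while in the eigenbasis only eigenvalues from [lam j]
    downwards occur. *)
Lemma weyl_lower (j : 'I_m) : nu j - s <= lam j.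
Proof.
have jn : (j < n)%N := leq_trans (ltn_ord j) m_le_n.
have [x [x_gt0 xE x_hi x_lo]] :=
  exists_orthogonal_combination (fun l : 'I_m => xi l) j e_on.
rewrite -(ler_pM2r x_gt0).
have xiE := orthonormal_basis_expansion (eigenvectors_orthonormal (leqnn n)) x.
apply: (@le_trans _ _ (dot x (Sigma *m x))).
  rewrite quadratic_form_spiked mulrBl lerD //; last first.
    by have := spectral_norm_quadratic x; rewrite ler_norml => /andP[].
  rewrite (dot_combination xE) mulr_sumr ler_sum // => i _.
  rewrite -mulrA -expr2; have [ij|ji] := leqP i j.
    by rewrite ler_wpM2r ?sqr_ge0 ?nu_anti.
  by rewrite x_hi // expr0n !mulr0.
rewrite (quadratic_form_eigen (leqnn n) xiE) (dot_combination xiE) mulr_sumr.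
rewrite ler_sum // => i _; have [ij|ji] := ltnP i j.
  have im : (i < m)%N by rewrite (ltn_trans ij).
  by rewrite (x_lo (Ordinal im) ij) expr0n !mulr0.
by case: eig => _ _ lam_anti; rewrite ler_wpM2r ?sqr_ge0 ?lam_anti.
Qed.

(** The same argument with the roles of [e] and [xi] exchanged. *)
Lemma weyl_upper (j : 'I_m) : lam j <= nu j + s.
Proof.
have jn : (j < n)%N := leq_trans (ltn_ord j) m_le_n.
have [x [x_gt0 xE x_hi x_lo]] :=
  exists_orthogonal_combination e j (eigenvectors_orthonormal m_le_n).
rewrite -(ler_pM2r x_gt0).
apply: (@le_trans _ _ (dot x (Sigma *m x))).
  rewrite (quadratic_form_eigen m_le_n xE) (dot_combination xE) mulr_sumr.
  rewrite ler_sum // => i _; have [ij|ji] := leqP i j.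
    by case: eig => _ _ lam_anti; rewrite ler_wpM2r ?sqr_ge0 ?lam_anti.
  by rewrite x_hi // expr0n !mulr0.
rewrite quadratic_form_spiked mulrDl lerD //; last first.
  exact: le_trans (ler_norm _) (spectral_norm_quadratic x).
(* Here [x] may leave the span of [e], so Bessel's inequality and [nu j >= 0] replace the exact
   expansion. *)
apply: (@le_trans _ _ (nu j * \sum_i dot (e i) x ^+ 2)); last first.
  by rewrite ler_wpM2l ?bessel.
rewrite mulr_sumr ler_sum // => i _.
rewrite -mulrA -expr2; have [ij|ji] := ltnP i j.
  by rewrite x_lo // expr0n !mulr0.
by rewrite ler_wpM2r ?sqr_ge0 ?nu_anti.
Qed.

(** * Eigenvector perturbation under the gap [g] *)

Context {g : R}.
Hypothesis g_gt0 : 0 < g.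
Hypothesis g_le : forall i, g <= nu i.
Hypothesis g_gap : forall i k : 'I_m, i != k -> g <= `|nu i - nu k|.

Section SmallPerturbation.
Hypothesis s_lt : s < g / 2.
Variable j : 'I_m.

Local Notation v := (xi j).

Lemma eigenvector_lt : (j < n)%N.
Proof. exact: leq_trans (ltn_ord j) m_le_n. Qed.

Lemma enorm_eigenvector : enorm v = 1.
Proof. by rewrite enormE eigenvector_dot ?eigenvector_lt // eqxx sqrtr1. Qed.

Lemma eigenvector_offdiag (i : 'I_m) : i != j -> `|dot (e i) v| <= 2 * s / g.
Proof.
move=> ij; have lo := weyl_lower j; have up := weyl_upper j.
have gap := g_gap ij.
(* [nu i] and [nu j] are at least [g] apart, and Weyl puts [lam j] within [s < g / 2] of [nu j]. *)
have far : g / 2 <= `|lam j - nu i|.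
  have := ler_distD (lam j) (nu i) (nu j); rewrite (distrC (nu i) (lam j)).
  have : `|lam j - nu j| <= s by rewrite ler_norml; apply/andP; split; lra.
  by have := s_lt; lra.
have key : (lam j - nu i) * dot (e i) v = dot (e i) (S *m v).
  rewrite mulrBl -dotZr -eigenvector_eq ?eigenvector_lt // quadratic_form_spiked.
  rewrite (bigD1 i) //= e_on eqxx mulr1 big1 => [|k ki].
    by rewrite addr0 addrAC subrr add0r.
  by rewrite e_on (negPf ki) mulr0.
have := dot_mulmx_bound S (e i) v.
rewrite -key normrM enorm_eigenvector enorm_orthonormal // !mulr1 => le_s.
rewrite ler_pdivlMr //.
have := ler_wpM2r (normr_ge0 (dot (e i) v)) far; lra.
Qed.

Lemma eigenvector_residual : enorm (residual (e := e) v) <= 2 * s / g.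
Proof.
set w := residual v.
have lam_ge : g / 2 <= lam j.
  by have := weyl_lower j; have := g_le j; have := s_lt; lra.
have key : lam j * (enorm w * enorm w) = dot w (S *m v).
  rewrite -expr2 sqr_enorm -dot_residual_self // -dotZr.
  rewrite -eigenvector_eq ?eigenvector_lt // quadratic_form_spiked big1 ?add0r //.
  by move=> i _; rewrite dot_residual // mulr0.
(* One factor [enorm w] is to be cancelled from [key]. If it is zero, only [0 <= s] remains, seen by
   applying [S] to the unit vector [v]. *)
have [w0|w0] := eqVneq (enorm w) 0.
  rewrite w0 mulr_ge0 ?invr_ge0 ?(ltW g_gt0) // mulr_ge0 //.
  have := spectral_norm_bound S v; rewrite enorm_eigenvector mulr1.
  exact: le_trans (enorm_ge0 _).
have w_gt0 : 0 < enorm w by rewrite lt0r w0 enorm_ge0.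
have := le_trans (ler_norm _) (dot_mulmx_bound S w v).
rewrite -key enorm_eigenvector mulr1 mulrA ler_pM2r // => le_s.
rewrite ler_pdivlMr //.
have := ler_wpM2r (ltW w_gt0) lam_ge; lra.
Qed.

Lemma eigenvector_close : 0 <= dot (e j) v ->
  enorm (v - e j) <= 4 * m%:R / g * s.
Proof.
set a := dot (e j) v => a_ge0.
have rest : enorm (v - a *: e j) <= m%:R * (2 * s / g).
  have -> : v - a *: e j =
      residual (e := e) v + \sum_(i | i != j) dot (e i) v *: e i.
    by rewrite /residual (bigD1 j) //= opprD addrA subrK.
  apply: le_trans (enormD _ _) _.
  (* The factor [m] counts the residual once and each of the [m - 1] indices other than [j] once. *)
  have -> : m%:R = 1 + \sum_(i < m | i != j) 1 :> R.
    by rewrite -(bigD1 (P := predT) j) //= sumr_const card_ord.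
  rewrite mulrDl mul1r lerD ?eigenvector_residual // mulr_suml.
  apply: le_trans (enorm_sum _ _) _; apply: ler_sum => i ij.
  by rewrite enormZ enorm_orthonormal // mul1r mulr1 eigenvector_offdiag.
(* The triangle inequality for the unit vector [v] gives [1 - a <= enorm (v - a *: e j)]; moving
   from [a *: e j] to [e j] thus at most doubles the error, whence the constant 4. *)
have one_le : 1 <= a + enorm (v - a *: e j).
  have := enormD (a *: e j) (v - a *: e j).
  by rewrite subrKC enorm_eigenvector enormZ enorm_orthonormal // mulr1 ger0_norm.
have a_le1 : a <= 1.
  have := le_trans (ler_norm _) (cauchy_schwarz (e j) v).
  by rewrite enorm_eigenvector enorm_orthonormal // mulr1.
have -> : v - e j = (v - a *: e j) + (a - 1) *: e j.
  by rewrite scalerBl scale1r addrA subrK.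
apply: le_trans (enormD _ _) _.
rewrite enormZ enorm_orthonormal // mulr1 distrC ger0_norm ?subr_ge0 //.
have -> : 4 * m%:R / g * s = 2 * (m%:R * (2 * s / g)) by field; rewrite gt_eqF.
lra.
Qed.

End SmallPerturbation.

Lemma spiked_eigenvector_bound (j : 'I_m) : 0 <= dot (e j) (xi j) ->
  enorm (xi j - e j) <= 4 * m%:R / g * s.
Proof.
move=> sgn; have [s_ge|s_lt] := lerP (g / 2) s; last exact: eigenvector_close.
apply: (@le_trans _ _ 2).
  apply: le_trans (enormD _ _) _.
  by rewrite enormN enorm_eigenvector enorm_orthonormal.
(* With [s >= g / 2], the bound is at least [2 * m], and [m >= 1] because [j] inhabits ['I_m]. *)
have m_ge1 : 1 <= m%:R :> R by rewrite ler1n (leq_ltn_trans _ (ltn_ord j)).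
rewrite mulrAC ler_pdivlMr //.
have s_ge0 : 0 <= s by have := g_gt0; lra.
have := ler_wpM2r s_ge0 m_ge1; lra.
Qed.

End SpikedMatrix.

(** * The loading matrix and the factor model *)

Lemma gram_entry (R : realType) (n m : nat) (B : 'M[R]_(n, m)) (i k : 'I_m) :
  (B^T *m B) i k = dot (col i B) (col k B).
Proof. by rewrite mxE; apply: eq_bigr => l _; rewrite !mxE. Qed.

(** Converts the lower bound on the eigenvalues of the scaled Gram matrix into one on the squared
    column norms. *)
Lemma eigenvalue_diag (F : fieldType) (n : nat) (A : 'M[F]_n) (i : 'I_n) :
  is_diag_mx A -> eigenvalue A (A i i).
Proof.
move=> /is_diag_mxP A_diag; apply/eigenvalueP; exists (delta_mx 0 i).
  rewrite -rowE; apply/matrixP => a k; rewrite !mxE ord1 eqxx /=.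
  by have [->|ki] := eqVneq k i; rewrite ?mulr1 // mulr0 A_diag // eq_sym.
by apply/eqP => /matrixP /(_ 0 i) /eqP; rewrite !mxE !eqxx oner_eq0.
Qed.

(** [B *m B^T] is the sum of the rank-one matrices built from the columns of [B]. *)
Lemma gram_diag_expansion (R : realType) (n m : nat) (B : 'M[R]_(n, m))
    (x : 'cV[R]_n) :
  B *m B^T *m x = \sum_i dot (col i B) x *: col i B.
Proof.
rewrite -mulmxA; apply/matrixP => l k; rewrite ord1 summxE mxE.
apply: eq_bigr => i _; rewrite dot_row !mxE mulrC; congr (dot _ _ * _).
by apply/matrixP => a b; rewrite !mxE.
Qed.

Theorem proposition2p2 (R : realType) (K : nat) (K_gt0 : (0 < K)%N)
  (d : nat -> measure_display)
  (T : forall p : nat, measurableType (d p))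
  (P : forall p : nat, probability (T p) R)
  (B : forall p : nat, 'M[R]_(p, K))
  (f : forall p : nat, 'I_K -> {RV (P p) >-> R})
  (u y : forall p : nat, 'I_p -> {RV (P p) >-> R})
  (Sigma_u Sigma : forall p : nat, 'M[R]_p)
  (lam : nat -> nat -> R)
  (xi : forall p : nat, nat -> 'cV[R]_p)
  (f_L2 : forall p k, (f p k : T p -> R) \in Lfun (P p) 2%:E)
  (u_L2 : forall p i, (u p i : T p -> R) \in Lfun (P p) 2%:E)
  (model : forall p i w,
    y p i w = \sum_(k < K) B p i k * f p k w + u p i w)
  (uncorrelated : forall p k i, covariance (P p) (f p k) (u p i) = 0%E)
  (Sigma_uE : forall p, Sigma_u p = covmx (u p))
  (SigmaE : forall p, Sigma p = covmx (y p))
  (B_ordered : forall p (i j : 'I_K), (i <= j)%N ->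
    enorm (col j (B p)) <= enorm (col i (B p)))
  (xi_eigen : forall p, ordered_eigensystem (Sigma p) (lam p) (xi p))
  (xi_sign : forall p (j : 'I_K), (j < p)%N ->
    0 <= ((xi p j)^T *m col j (B p)) 0 0)
  (pervasive : eigenvalues_bounded_away_from_zero
    (fun p => p%:R^-1 *: ((B p)^T *m B p)))
  (Sigma_decomp : forall p,
    Sigma p = B p *m covmx (f p) *m (B p)^T + Sigma_u p)
  (cov_f : forall p, covmx (f p) = 1%:M)
  (BtB_diag : forall p, is_diag_mx ((B p)^T *m B p))
  (B_distinct : asymptotically_distinct_columns B) :
  forall j : 'I_K,
    (fun p : nat =>
       enorm (xi p j - (enorm (col j (B p)))^-1 *: col j (B p)) : R^o)
    =O_\oo
    (fun p : nat => p%:R^-1 * spectral_norm (Sigma_u p) : R^o).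
Proof.
move=> j.
have [c c_gt0 perv] := pervasive; have [c' c'_gt0 dist] := B_distinct.
(* The minimum lets [g * p] bound both the squared column norms and their gaps. *)
pose g := Num.min c c'; have g_gt0 : 0 < g by rewrite lt_min c_gt0.
have C_gt0 : 0 < 4 * K%:R / g by rewrite divr_gt0 // mulr_gt0 // ltr0n.
apply/eqO_exP; exists (4 * K%:R / g) => //.
near=> p.
have p_ge : (K <= p)%N by near: p; exact: nbhs_infty_ge.
have p_gt0 : 0 < p%:R :> R by rewrite ltr0n (leq_trans K_gt0).
have eig_ge : forall a, eigenvalue (p%:R^-1 *: ((B p)^T *m B p)) a -> c <= `|a|.
  by near: p.
have gap : forall i k : 'I_K, i != k -> c' * p%:R <=
    `| enorm (col i (B p)) ^+ 2 - enorm (col k (B p)) ^+ 2 | by near: p.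
pose b i := col i (B p); pose e i := (enorm (b i))^-1 *: b i.
have g_le i : g * p%:R <= enorm (b i) ^+ 2.
  have diag : is_diag_mx (p%:R^-1 *: ((B p)^T *m B p)).
    apply/is_diag_mxP => k l kl; rewrite mxE.
    by have /is_diag_mxP -> := BtB_diag p; rewrite ?mulr0.
  have := eig_ge _ (eigenvalue_diag i diag).
  rewrite mxE gram_entry -sqr_enorm ger0_norm ?mulr_ge0 ?invr_ge0 ?ler0n ?enorm_ge0 //.
  rewrite mulrC ler_pdivlMr //; apply: le_trans.
  by rewrite ler_pM2r // ge_min lexx.
have b_neq0 i : enorm (b i) != 0.
  by rewrite -sqrf_eq0 gt_eqF // (lt_le_trans _ (g_le i)) ?mulr_gt0.
have e_on : orthonormal_family e.
  move=> i k; rewrite dotZl dotZr; have [<-|ik] := eqVneq i k.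
    by rewrite -sqr_enorm mulrA expr2 -invfM mulVf ?mulf_neq0.
  have /is_diag_mxP/(_ i k ik) := BtB_diag p.
  by rewrite gram_entry => ->; rewrite !mulr0.
(* Normalising the columns turns [B *m B^T] into spikes of strength [enorm (b i) ^+ 2]. *)
have SigmaE' x : Sigma p *m x =
    \sum_i (enorm (b i) ^+ 2 * dot (e i) x) *: e i + Sigma_u p *m x.
  rewrite Sigma_decomp cov_f mulmx1 mulmxDl gram_diag_expansion; congr (_ + _).
  apply: eq_bigr => i _; rewrite dotZl scalerA; congr (_ *: _).
  by field; exact: b_neq0.
have sgn : 0 <= dot (e j) (xi p j).
  rewrite dotZl dotC dotE mulr_ge0 ?invr_ge0 ?enorm_ge0 // xi_sign //.
  exact: leq_trans (ltn_ord j) p_ge.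
have anti (i k : 'I_K) : (i <= k)%N -> enorm (b k) ^+ 2 <= enorm (b i) ^+ 2.
  by move=> ik; rewrite lerXn2r ?nnegrE ?enorm_ge0 ?B_ordered.
have sep (i k : 'I_K) : i != k ->
    g * p%:R <= `|enorm (b i) ^+ 2 - enorm (b k) ^+ 2|.
  move=> ik; apply: le_trans (gap i k ik).
  by rewrite ler_pM2r // ge_min lexx orbT.
(* With gap [g * p] the bound is [4 * K / (g * p)] times the spectral norm; the factor [1 / p] is
   the claimed rate. *)
have := spiked_eigenvector_bound p_ge e_on (fun i => sqr_ge0 _) anti SigmaE'
  (xi_eigen p) (mulr_gt0 g_gt0 p_gt0) g_le sep sgn.
rewrite ger0_norm ?enorm_ge0 // => /le_trans; apply.
rewrite normrM (ger0_norm (_ : 0 <= p%:R^-1)) ?invr_ge0 ?ler0n //.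
by rewrite invfM !mulrA ler_pM2l ?ler_norm // divr_gt0.
Unshelve. all: by end_near.
Qed.
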